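(* For all integers $n \geq 0$, $$dp(27n+16) \equiv 0 \pmod{3}.$$
   Context: A partition of a positive integer $n$ is a nonincreasing sequence of positive integers (called parts) whose sum is $n$. For $n\ge 0$, $dp(n)$ denotes the number of partitions of $n$ in which every part is either divisible by $4$ or congruent to $\pm 1 \pmod 6$ (with $dp(0)=1$). Equivalently, its generating function is $$\sum_{n=0}^{\infty} dp(n)q^n = \frac{1}{(q;q^6)_\infty (q^5;q^6)_\infty (q^4;q^4)_\infty},$$ where $(a;q)_\infty := (1-a)(1-aq)(1-aq^2)\cdots$. *)

(* Defs.v *)
From mathcomp Require Import all_boot.

Set Implicit Arguments.
Unset Strict Implicit.
Unset Printing Implicit Defensive.

Definition is_partition (n : nat) (s : seq nat) : bool :=
  [&& sorted geq s, all (fun x => 0 < x) s & sumn s == n].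

Definition dp_part (x : nat) : bool :=
  [|| 4 %| x, x == 1 %[mod 6] | x == 5 %[mod 6]].

Definition is_dp_partition (n : nat) (s : seq nat) : bool :=
  is_partition n s && all dp_part s.

(* A partition of n has at most n parts, each at most n, so counting sequences
   of length at most n over {0, ..., n} misses none: see dp_enum. *)
Definition dp (n : nat) : nat :=
  #|[set s : n.-bseq 'I_n.+1 | is_dp_partition n (map val s)]|.

Lemma leq_size_sumn (s : seq nat) : all (fun x => 0 < x) s -> size s <= sumn s.
Proof.
elim: s => //= x s IHs /andP[x_gt0 s_gt0].
by rewrite -add1n leq_add ?IHs.
Qed.

Lemma leq_sumn (s : seq nat) x : x \in s -> x <= sumn s.
Proof.
elim: s => //= y s IHs; rewrite inE => /orP[/eqP-> | /IHs xs].
  exact: leq_addr.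
exact: leq_trans xs (leq_addl _ _).
Qed.

Lemma dp_enum n : exists e : seq (seq nat),
  [/\ uniq e, forall s, (s \in e) = is_dp_partition n s & size e = dp n].
Proof.
pose f (s : n.-bseq 'I_n.+1) : seq nat := map val s.
have f_inj : injective f by move=> s t /(inj_map val_inj)/val_inj.
exists [seq f s | s <- enum [set s : n.-bseq 'I_n.+1 | is_dp_partition n (f s)]].
split; last by rewrite size_map -cardE.
  by rewrite map_inj_uniq ?enum_uniq.
move=> s; apply/mapP/idP => [[t]|]; first by rewrite mem_enum inE => ? ->.
move=> dps; have /andP[/and3P[_ s_gt0 /eqP sum_s] _] := dps.
have sz : size (map (@inord n) s) <= n.
  by rewrite size_map -[leqRHS]sum_s leq_size_sumn.
have fE : f (Bseq sz) = s.
  rewrite /f /= -map_comp -[RHS]map_id; apply/eq_in_map => x xs /=.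
  by rewrite inordK // ltnS -[leqRHS]sum_s leq_sumn.
by exists (Bseq sz); rewrite ?mem_enum ?inE fE.
Qed.

(* Main.v *)
Require Import Defs.
From mathcomp Require Import all_boot.
From mathcomp Require Import all_algebra.
From mathcomp Require Import zify ring.

(* Modulo 3 one has f(q^3) = f(q)^3. Put E_k = (q^k; q^k), o = (q; q^2),
   u = (q; q^6)(q^5; q^6). Then u o^2 = 1 and E_6 = E_2^3 modulo 3, which turns
   the generating function D = 1 / (u E_4) into phi(-q) phi(-q^2) / E_2^3. By the
   triple product, the part of phi(-q) with exponents = 1 mod 3 is q (u E_6)^3,
   while phi(-q^2) has only exponents = 0, 2 mod 3; as psi^2 = u E_6 / E_2, the
   terms of D with exponents = 1 mod 3 are those of
   q psi(q^3)^2 phi(-q^18). Its exponents 1 + 3 t + 3 t' + 18 y^2, with t, t'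
   triangular, are never congruent to 16 modulo 27. Power series are truncated:
   the computation takes place in F_3[X] / (X^M). *)

Set Implicit Arguments.
Unset Strict Implicit.
Unset Printing Implicit Defensive.

Import GRing.Theory.
Local Open Scope ring_scope.

(** * The finite triple product *)

(* tri k = k (k + 1) / 2; note that Negz n stands for - (n + 1). *)
Definition tri (k : int) : nat :=
  match k with Posz n => 'C(n.+1, 2) | Negz n => 'C(n.+1, 2) end.

Lemma tri_double (k : int) : (tri k)%:Z * 2 = k * (k + 1).
Proof.
have binE n : ('C(n.+1, 2))%:Z * 2 = n%:Z * (n%:Z + 1).
  by have := mul_bin_left n.+1 1; rewrite bin1 => E; nia.
by case: k => n; rewrite /= binE // NegzE; lia.
Qed.

Lemma tri_succ (k : int) : (tri k)%:Z = (tri (k - 1))%:Z + k.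
Proof. by have := tri_double k; have := tri_double (k - 1); nia. Qed.

Section QSeries.
Variable A : comNzRingType.
Implicit Types a b Q : A.

Definition qpoch a Q n := \prod_(i < n) (1 - a * Q ^+ i).

Lemma qpochS a Q n : qpoch a Q n.+1 = qpoch a Q n * (1 - a * Q ^+ n).
Proof. by rewrite /qpoch big_ord_recr. Qed.

(** The Gaussian binomial coefficient, by a Pascal recursion: a quotient would need q-factorials
    that are invertible in [A]. *)
Fixpoint qbinom Q (m j : nat) : A :=
  match j, m with
  | 0%N, _ => 1
  | _.+1, 0%N => 0
  | j'.+1, m'.+1 => qbinom Q m' j' + Q ^+ j * qbinom Q m' j
  end.

Lemma qbinom0 Q m : qbinom Q m 0 = 1. Proof. by case: m. Qed.

Lemma qbinomS Q m j :
  qbinom Q m.+1 j.+1 = qbinom Q m j + Q ^+ j.+1 * qbinom Q m j.+1.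
Proof. by []. Qed.

Lemma qbinom_small Q m j : (m < j)%N -> qbinom Q m j = 0.
Proof.
elim: m j => [|m IHm] [|j] //; rewrite ltnS => lt_mj.
by rewrite qbinomS !IHm ?mulr0 ?addr0 // ltnW.
Qed.

(** The mirror-image Pascal rule: the defining one serves to add a factor in b to the triple
    product, this one a factor in a. *)
Lemma qbinomSr Q m j : (j <= m)%N ->
  qbinom Q m.+1 j.+1 = qbinom Q m j.+1 + Q ^+ (m - j) * qbinom Q m j.
Proof.
elim: m j => [|m IHm] [|j] // le_jm; rewrite qbinomS.
- by rewrite /= mulr0 addr0 add0r mul1r.
- have E := IHm 0%N isT; rewrite !qbinom0 subn0 mulr1 in E *.
  by rewrite [in RHS]qbinomS E !qbinom0 [_ ^+ m.+1]exprS; ring.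
rewrite ltnS in le_jm.
have := IHm j le_jm; rewrite [X in X = _ -> _]qbinomS => E.
case: (ltnP j m) => [lt_jm|le_mj].
  have := IHm j.+1 lt_jm => E'.
  rewrite [X in _ + _ * X]E' [qbinom _ m.+1 j.+1 in LHS]E [in RHS]qbinomS.
  rewrite [qbinom _ m.+1 j.+1 in RHS]qbinomS !subSS.
  have QE : Q ^+ j.+2 * Q ^+ (m - j.+1) = Q ^+ (m - j) * Q ^+ j.+1.
    by rewrite -!exprD; congr (_ ^+ _); lia.
  by rewrite mulrDr mulrA QE; ring.
have -> : j = m by apply/eqP; rewrite eqn_leq le_jm.
by rewrite subnn expr0 !(qbinom_small _ (ltnSn _)) mulr0 add0r mul1r addr0.
Qed.

Lemma qbinom_qpoch Q m j : (j <= m)%N ->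
  qbinom Q m j * (qpoch Q Q j * qpoch Q Q (m - j)) = qpoch Q Q m.
Proof.
elim: m j => [|m IHm] [|j] // le_jm; rewrite ?qbinom0 ?subn0.
- by rewrite /qpoch !big_ord0 !mulr1.
- by rewrite {1}/qpoch big_ord0 !mul1r.
rewrite ltnS in le_jm; rewrite qbinomSr // subSS.
have QE : Q ^+ (m - j) * Q ^+ j.+1 = Q ^+ m.+1.
  by rewrite -exprD; congr (_ ^+ _); lia.
have E0 := IHm j le_jm.
(* The two halves are (Q; Q)_m times 1 - Q^(m-j) and Q^(m-j) (1 - Q^(j+1)), which add up to 1 -
   Q^(m+1). *)
rewrite mulrDl [X in _ + X](_ : _ = qpoch Q Q m * Q ^+ (m - j) * (1 - Q ^+ j.+1)).
  have -> : qbinom Q m j.+1 * (qpoch Q Q j.+1 * qpoch Q Q (m - j)) =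
    qpoch Q Q m * (1 - Q ^+ (m - j)).
    case: (ltnP j m) => [lt_jm|le_mj].
      have -> : qpoch Q Q (m - j) = qpoch Q Q (m - j.+1) * (1 - Q ^+ (m - j)).
        by rewrite -(subnSK lt_jm) qpochS exprS.
      by rewrite -(IHm j.+1 lt_jm) !mulrA.
    have -> : j = m by apply/eqP; rewrite eqn_leq le_jm.
    by rewrite qbinom_small // subnn expr0 subrr mulr0 mul0r.
  by rewrite (qpochS _ _ m) -exprS -QE; ring.
by rewrite -E0 qpochS exprS; ring.
Qed.

Definition theta_term a b (k : int) := a ^+ tri k * b ^+ tri (k - 1).

(** Formally, consecutive terms have ratio a (a b)^(k-1); the factor (a b)^n and the bound on k keep
    the exponents natural. *)
Lemma theta_term_pred a b (k : int) n : k <= n.+1%:Z ->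
  a * (a * b) ^+ n * theta_term a b (k - 1) =
  (a * b) ^+ `|n.+1%:Z - k| * theta_term a b k.
Proof.
move=> le_kn; rewrite /theta_term !exprMn.
have -> : a * (a ^+ n * b ^+ n) * (a ^+ tri (k - 1) * b ^+ tri (k - 1 - 1)) =
    a ^+ (1 + n + tri (k - 1)) * b ^+ (n + tri (k - 1 - 1)).
  by rewrite !exprD expr1; ring.
rewrite mulrACA -!exprD.
have := tri_succ k; have := tri_succ (k - 1) => E1 E2.
by congr (_ ^+ _ * _ ^+ _); lia.
Qed.

Lemma theta_term_succ a b (k : int) n : - n.+1%:Z <= k ->
  b * (a * b) ^+ n * theta_term a b (k + 1) =
  (a * b) ^+ `|n.+1%:Z + k| * theta_term a b k.
Proof.
move=> le_nk; rewrite /theta_term !exprMn addrK.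
have -> : b * (a ^+ n * b ^+ n) * (a ^+ tri (k + 1) * b ^+ tri k) =
    a ^+ (n + tri (k + 1)) * b ^+ (1 + n + tri k).
  by rewrite !exprD expr1; ring.
rewrite mulrACA -!exprD.
have := tri_succ k; have := tri_succ (k + 1); rewrite addrK => E1 E2.
by congr (_ ^+ _ * _ ^+ _); lia.
Qed.

(* Ramanujan's f(a, b) = \sum_k a^(k(k+1)/2) b^(k(k-1)/2), cut off at |k| <= N. *)
Definition theta N a b := \sum_(j < N.*2.+1) theta_term a b (j%:Z - N%:Z).

(** Cauchy's finite form of the Jacobi triple product, by induction on K at N = 0, then on N. A new
    factor 1 + c gives the old sum plus a copy with shifted index, and a Pascal rule merges the
    two. *)
Lemma finite_triple_product a b N K :
  qpoch (- a) (a * b) N * qpoch (- b) (a * b) K =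
  \sum_(j < (N + K).+1) theta_term a b (j%:Z - K%:Z) * qbinom (a * b) (N + K) j.
Proof.
set Q := a * b.
elim: N => [|N IHN].
  rewrite {1}/qpoch big_ord0 mul1r add0n.
  elim: K => [|K IHK].
    by rewrite /qpoch big_ord0 big_ord_recl big_ord0 addr0 mulr1 /theta_term !mulr1.
  rewrite qpochS IHK.
  rewrite [RHS]big_ord_recl /=.
  rewrite mulNr opprK mulrDr mulr1.
  rewrite [X in _ = _ + X](eq_bigr (fun i : 'I_K.+1 =>
     theta_term a b (i%:Z - K%:Z) * qbinom Q K i +
     theta_term a b (i%:Z - K%:Z) * Q ^+ i.+1 * qbinom Q K i.+1)); last first.
    move=> i _; rewrite /bump /= add1n mulrDr mulrA.
    by congr (theta_term _ _ _ * _ + theta_term _ _ _ * _ * _); lia.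
  rewrite big_split /= addrCA; congr (_ + _).
  rewrite [X in _ = _ + X]big_ord_recr /= qbinom_small // mulr0 addr0.
  rewrite mulrC mulr_sumr big_ord_recl /= qbinom0 !mulr1; congr (_ + _).
    rewrite (_ : 0%:Z - K%:Z = (0%:Z - K.+1%:Z) + 1); last by lia.
    by rewrite theta_term_succ; [rewrite (_ : `|_|%N = 0%N) ?expr0 ?mul1r //; lia | lia].
  apply: eq_bigr => i _; rewrite /bump /= add1n.
  rewrite mulrA (_ : i.+1%:Z - K%:Z = (i%:Z - K%:Z) + 1); last by lia.
  rewrite theta_term_succ; last by lia.
  by congr (_ * _); rewrite mulrC; congr (_ * _ ^+ _); lia.
rewrite qpochS mulrAC IHN mulNr opprK mulrDr mulr1 addSn.
rewrite [RHS]big_ord_recl /=.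
rewrite [X in _ = _ + X](eq_bigr (fun i : 'I_(N + K).+1 =>
     theta_term a b (i.+1%:Z - K%:Z) * qbinom Q (N + K) i.+1 +
     theta_term a b (i.+1%:Z - K%:Z) * Q ^+ (N + K - i) * qbinom Q (N + K) i)); last first.
  move=> i _; rewrite /bump /= add1n add0n -qbinomS qbinomSr; last by rewrite -ltnS.
  by rewrite mulrDr mulrA.
rewrite big_split /= addrA; congr (_ + _).
  rewrite [X in _ = _ + X]big_ord_recr /= qbinom_small // mulr0 addr0.
  by rewrite big_ord_recl /= !qbinom0.
rewrite mulrC mulr_sumr; apply: eq_bigr => i _.
rewrite mulrA (_ : i%:Z - K%:Z = (i.+1%:Z - K%:Z) - 1); last by lia.
have ltiN := ltn_ord i.
rewrite theta_term_pred; last by lia.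
by congr (_ * _); rewrite mulrC; congr (_ * _ ^+ _); lia.
Qed.

End QSeries.

(** * Dissections, and the triple product modulo a nilpotent *)

Lemma triN (k : int) : tri (- k) = tri (k - 1).
Proof. have := tri_double (- k); have := tri_double (k - 1). nia. Qed.

Section Dissections.
Variable A : comNzRingType.
Implicit Types a b Q y z : A.

Lemma prod_dissect (F : nat -> A) m n :
  \prod_(i < m * n) F i = \prod_(r < m) \prod_(j < n) F (m * j + r)%N.
Proof.
elim: n => [|n IHn].
  by rewrite muln0 big_ord0 big1 // => r _; rewrite big_ord0.
rewrite mulnSr big_split_ord /= IHn -big_split /=.
by apply: eq_bigr => r _; rewrite big_ord_recr.
Qed.

Lemma qpoch_dissect a Q m n :
  qpoch a Q (m * n) = \prod_(r < m) qpoch (a * Q ^+ r) (Q ^+ m) n.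
Proof.
rewrite /qpoch (prod_dissect (fun i => 1 - a * Q ^+ i)).
apply: eq_bigr => r _; apply: eq_bigr => j _.
by rewrite exprD -exprM; ring.
Qed.

Lemma qpoch_oppM a Q n : qpoch (- a) Q n * qpoch a Q n = qpoch (a ^+ 2) (Q ^+ 2) n.
Proof.
rewrite /qpoch -big_split /=; apply: eq_bigr => i _.
by rewrite -exprM mulnC exprM; ring.
Qed.

Lemma theta_termC a b (k : int) : theta_term a b k = theta_term b a (- k).
Proof.
rewrite /theta_term mulrC triN.
by rewrite -[in RHS]opprD triN addrK.
Qed.

Lemma thetaC N a b : theta N a b = theta N b a.
Proof.
rewrite /theta (reindex_inj rev_ord_inj) /=; apply: eq_bigr => j _.
by rewrite theta_termC; congr theta_term; have := ltn_ord j; lia.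
Qed.

(** [theta_term z z k] is z^(k^2), and the squares of 3 k, 3 k - 1, 3 k + 1 are 9 k^2, 9 k^2 - 6 k +
    1, 9 k^2 + 6 k + 1. *)
Lemma theta_term_triple z (k : int) :
  theta_term z z (3 * k) + (theta_term z z (3 * k - 1) + theta_term z z (3 * k + 1)) =
  theta_term (z ^+ 9) (z ^+ 9) k +
  (z * theta_term (z ^+ 3) (z ^+ 15) k + z * theta_term (z ^+ 15) (z ^+ 3) k).
Proof.
have E3k : (tri (3 * k))%:Z = 9 * (tri (k - 1))%:Z + 6 * k.
  by have := tri_double (3 * k); have := tri_double (k - 1); nia.
have pred3k : 3 * k - 1 = 3 * (k - 1) + 2 by lia.
rewrite /theta_term !addrK pred3k.
move: (3 * (k - 1) + 2) pred3k => m Em.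
have Em' : (tri (3 * k))%:Z = (tri m)%:Z + 3 * k by rewrite -Em; exact: tri_succ.
have := tri_succ k; have := tri_succ (3 * k + 1); rewrite addrK => E1 E2.
have := tri_succ m => E3.
rewrite -!exprM -!exprD -!exprS.
congr (_ ^+ _ + (_ ^+ _ + _ ^+ _)); lia.
Qed.

(* With z = - q, the terms of phi(-q) with exponent 0, resp. 1, modulo 3. *)
Definition theta_mod0 N z := theta N (z ^+ 9) (z ^+ 9).

Definition theta_mod1 N z := (z * theta N (z ^+ 3) (z ^+ 15)) *+ 2.

(** The range |j| <= 3 N + 1 splits exactly into the triples around 3 k with |k| <= N. The classes
    of 1 and - 1 give equal sums by [thetaC], whence the factor 2 in [theta_mod1]. *)
Lemma theta_dissect N z :
  theta (3 * N + 1) z z = theta_mod0 N z + theta_mod1 N z.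
Proof.
rewrite /theta_mod0 /theta_mod1.
rewrite mulr2n {2}thetaC /theta !mulr_sumr.
rewrite -(big_mkord xpredT (fun j => theta_term z z (j%:Z - (3 * N + 1)%:Z))).
rewrite (_ : ((3 * N + 1).*2.+1 = 3 * N.*2.+1)%N); last by lia.
rewrite -!big_split /=.
elim: (N.*2.+1) => [|n IHn]; first by rewrite muln0 big_geq // big_ord0.
rewrite (_ : (3 * n.+1 = (3 * n).+3)%N); last by lia.
rewrite !big_nat_recr //= IHn big_ord_recr /= -!addrA; congr (_ + _).
set k := n%:Z - N%:Z.
rewrite (_ : (3 * n)%:Z - _ = 3 * k - 1); last by lia.
rewrite (_ : (3 * n).+1%:Z - _ = 3 * k); last by lia.
rewrite (_ : (3 * n).+2%:Z - _ = 3 * k + 1); last by lia.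
by rewrite -(theta_term_triple z k) addrCA addrA.
Qed.

End Dissections.

Section Nilpotent.
Variables (A : comUnitRingType) (M : nat).
Implicit Types a b Q y z : A.

Lemma geom_nilp y : y ^+ M = 0 -> (1 - y) * \sum_(i < M) y ^+ i = 1.
Proof.
by move=> yM0; rewrite -opprB mulNr -subrX1 yM0 sub0r opprK.
Qed.

Lemma unit_nilp y : y ^+ M = 0 -> 1 - y \is a GRing.unit.
Proof. by move=> /geom_nilp E; apply/unitrPr; exists (\sum_(i < M) y ^+ i). Qed.

Lemma nilpM y z : y ^+ M = 0 -> (y * z) ^+ M = 0.
Proof. by move=> y0; rewrite exprMn y0 mul0r. Qed.

Lemma nilp_leq y n : y ^+ M = 0 -> (M <= n)%N -> y ^+ n = 0.
Proof. by move=> y0 /subnKC <-; rewrite exprD y0 mul0r. Qed.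

Lemma qpoch_unit a Q n : a ^+ M = 0 -> qpoch a Q n \is a GRing.unit.
Proof. by move=> a0; apply: rpred_prod => i _; apply/unit_nilp/nilpM. Qed.

(** Factors of index at least M equal 1, so [qpoch a Q M] stands for the infinite product. *)
Lemma qpoch_stable a Q n : Q ^+ M = 0 -> (M <= n)%N -> qpoch a Q n = qpoch a Q M.
Proof.
move=> Q0 /subnKC <-; elim: (n - M)%N => [|k IHk]; first by rewrite addn0.
by rewrite addnS qpochS IHk (nilp_leq Q0) ?leq_addr // mulr0 subr0 mulr1.
Qed.

Lemma qpoch_nilp_dissect a Q m : (0 < m)%N -> Q ^+ M = 0 ->
  qpoch a Q M = \prod_(r < m) qpoch (a * Q ^+ r) (Q ^+ m) M.
Proof. by move=> m_gt0 Q0; rewrite -qpoch_dissect qpoch_stable // leq_pmull. Qed.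

(** In [finite_triple_product] with K = N, terms with |k| >= M vanish. In the others the lower index
    and its complement are at least M, so with Q = a b the Gaussian binomial is 1 / (Q; Q). *)
Lemma triple_product a b N : a ^+ M = 0 -> b ^+ M = 0 -> (M.*2 <= N)%N ->
  theta N (- a) (- b) =
  qpoch a (a * b) M * qpoch b (a * b) M * qpoch (a * b) (a * b) M.
Proof.
move=> a0 b0 leMN; have Q0 : (a * b) ^+ M = 0 by apply: nilpM.
have leMN' : (M <= N)%N by lia.
rewrite -(qpoch_stable a Q0 leMN') -(qpoch_stable b Q0 leMN').
have := finite_triple_product (- a) (- b) N N.
rewrite !opprK mulrNN addnn => ->; rewrite mulr_suml; apply: eq_bigr => j _.
rewrite -mulrA; have ltj := ltn_ord j.
case: (leqP M `|j%:Z - N%:Z|) => [leM|ltM].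
  suff -> : theta_term (- a) (- b) (j%:Z - N%:Z) = 0 by rewrite mul0r.
  have E := tri_succ (j%:Z - N%:Z); rewrite /theta_term (exprNn a) (exprNn b).
  (* The two exponents are natural numbers that differ by k = j - N, so the larger is at least
     |k|. *)
  have [leMt|leMt] : (M <= tri (j%:Z - N%:Z))%N \/ (M <= tri (j%:Z - N%:Z - 1))%N by lia.
    by rewrite (nilp_leq a0 leMt) mulr0 mul0r.
  by rewrite (nilp_leq b0 leMt) !mulr0.
suff -> : qbinom (a * b) N.*2 j * qpoch (a * b) (a * b) M = 1 by rewrite mulr1.
have := @qbinom_qpoch A (a * b) N.*2 j; rewrite !(qpoch_stable _ Q0); try lia.
move=> E; apply: (mulIr (qpoch_unit (a * b) M Q0)).
by rewrite mul1r -mulrA E //; lia.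
Qed.

End Nilpotent.

(** * Generating functions of partitions *)

Section PartitionGF.
Variables (R : comNzRingType) (M : nat) (P : pred nat).

Definition geom_poly k : {poly R} := \sum_(m < M) 'X^k ^+ m.

Definition partition_poly K : {poly R} :=
  \prod_(i < K) (if P i.+1 then geom_poly i.+1 else 1).

(** Since (1 - X^k) [geom_poly k] = 1 - X^(k M), the coefficients below M obey the recursion of p /
    (1 - X^k). *)
Lemma coef_mul_geom (p : {poly R}) k n : (0 < k)%N -> (n < M)%N ->
  (p * geom_poly k)`_n =
  p`_n + (if (k <= n)%N then (p * geom_poly k)`_(n - k) else 0).
Proof.
move=> k_gt0 ltnM.
have E : p * geom_poly k = p - p * 'X^(k * M) + p * geom_poly k * 'X^k.
  have := subrX1 ('X^k : {poly R}) M.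
  rewrite -exprM -/(geom_poly k) => /(congr1 (fun q => p * q)) E.
  have -> : p * 'X^(k * M) = p + p * (('X^k - 1) * geom_poly k).
    by rewrite -E; ring.
  by ring.
rewrite {1}E coefD coefB !coefMXn.
rewrite (leq_trans ltnM (leq_pmull _ k_gt0)) subr0.
by case: (ltnP n k).
Qed.

Definition bounded_partition k n s :=
  [&& is_partition n s, all P s & all (fun x => x <= k)%N s].

(** A part k + 1, being the largest allowed, heads the nonincreasing list; removing it mirrors the
    recursion of [coef_mul_geom]. *)
Lemma bounded_partitionSP k n s :
  reflect (bounded_partition k n s \/
    exists s', [/\ s = k.+1 :: s', P k.+1, (k < n)%N &
                   bounded_partition k.+1 (n - k.+1) s'])
  (bounded_partition k.+1 n s).
Proof.
apply: (iffP idP) => [|[|[s' [-> Pk ltkn]]]]; rewrite /bounded_partition /is_partition.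
- case: s => [|x s] /=; first by move=> ->; left.
  case/and3P=> /and3P[srt /andP[x_gt0 s_gt0] /eqP sum_s] /andP[Px Ps] /andP[lexk lesk].
  move: lexk; rewrite leq_eqVlt ltnS => /orP[/eqP Ex|lexk].
    subst x; right; exists s; split=> //; first by rewrite -sum_s leq_addr.
    by rewrite (path_sorted srt) s_gt0 Ps lesk -sum_s addKn eqxx.
  left; rewrite srt x_gt0 s_gt0 sum_s eqxx Px Ps lexk /=.
  have := srt; rewrite (path_sortedE (rev_trans leq_trans)) => /andP[/allP lesx _].
  by apply/allP => y /lesx /= leyx; apply: leq_trans lexk.
- case/and3P=> -> -> /allP les /=; apply/allP => y /les; exact: leqW.
case/and3P=> /and3P[srt s_gt0 /eqP sum_s] Ps les /=.
rewrite s_gt0 Ps Pk les leqnn sum_s subnKC // eqxx !andbT.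
by rewrite (path_sortedE (rev_trans leq_trans)) srt les.
Qed.

(** An arbitrary duplicate-free enumeration [e] lets the induction pass to sublists and to lists of
    tails. *)
Lemma coef_partition_poly k n (e : seq (seq nat)) : (n < M)%N -> uniq e ->
  (forall s, (s \in e) = bounded_partition k n s) ->
  (partition_poly k)`_n = (size e)%:R.
Proof.
elim: k n e => [|k IHk] n e ltnM uniq_e mem_e.
  rewrite /partition_poly big_ord0 coef1.
  suff -> : size e = (n == 0%N) by [].
  have : perm_eq e (if n == 0%N then [:: [::]] else [::]).
    apply: uniq_perm => // [|s]; first by case: eqP.
    rewrite mem_e /bounded_partition /is_partition.
    case: s => [|[|x] s] /=; rewrite ?andbF //; first by case: n {ltnM mem_e}.
      by case: eqP.
    by case: eqP.
  by move/perm_size ->; case: eqP.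
rewrite /partition_poly big_ord_recr /= -/(partition_poly k).
case: ifP => [Pk|nPk]; last first.
  rewrite mulr1; apply: IHk => // s; rewrite mem_e.
  by apply/bounded_partitionSP/idP => [[//|[s' []]]|]; [rewrite nPk | left].
(* Removing a part k + 1 lowers n but keeps the bound, hence this inner induction. *)
elim/ltn_ind: n e ltnM uniq_e mem_e => n IHn e ltnM uniq_e mem_e.
rewrite coef_mul_geom //.
pose small s := all (fun x => x <= k)%N s.
rewrite -(count_predC small e) natrD -!size_filter.
congr (_ + _).
  apply: IHk => //; first exact: filter_uniq.
  move=> s; rewrite mem_filter mem_e; apply/andP/idP => [[sm /bounded_partitionSP[//|]]|bp].
    by case=> s' [Es]; move: sm; rewrite Es /small /= ltnn.
  split; last by apply/bounded_partitionSP; left.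
  by case/and3P: bp.
set e2 := filter _ e.
have e2P s : reflect (exists s',
    [/\ s = k.+1 :: s', (k < n)%N & bounded_partition k.+1 (n - k.+1) s'])
    (s \in e2).
  rewrite mem_filter mem_e.
  apply: (iffP andP) => [[nsm /bounded_partitionSP[/and3P[_ _ sm]|]]|].
  - by move: nsm; rewrite /= /small sm.
  - by case=> s' [-> _ ltkn bp]; exists s'.
  case=> s' [-> ltkn bp]; split; first by rewrite /= /small /= ltnn.
  by apply/bounded_partitionSP; right; exists s'.
case: ifP => [lekn|nlekn]; last first.
  case E : e2 => [|s e3] //.
  have : s \in e2 by rewrite E mem_head.
  by case/e2P => s' [_]; rewrite nlekn.
rewrite -(size_map behead); apply: IHn; first by rewrite ltn_subrL (leq_trans _ lekn).
- exact: leq_ltn_trans (leq_subr _ _) ltnM.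
- rewrite map_inj_in_uniq ?filter_uniq // => s t /e2P[s' [-> _ _]] /e2P[t' [-> _ _]] /= -> //.
move=> s; apply/mapP/idP => [[t /e2P[s' [-> _ bp]] -> //]|bp].
by exists (k.+1 :: s) => //; apply/e2P; exists s.
Qed.

End PartitionGF.

Lemma coef_dp_poly (R : comNzRingType) M K n : (n < M)%N -> (n <= K)%N ->
  (partition_poly R M dp_part K)`_n = (dp n)%:R.
Proof.
move=> ltnM lenK; have [e [uniq_e mem_e <-]] := dp_enum n.
apply: coef_partition_poly => // s; rewrite mem_e.
apply/idP/idP => [/andP[pn ps]|/and3P[pn ps _]]; last by apply/andP.
apply/and3P; split=> //; apply/allP => x /leq_sumn.
by case/and3P: pn => _ _ /eqP-> lexn; apply: leq_trans lexn lenK.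
Qed.

(** * Identities in characteristic 3 *)

(* Here a + a' and b + b' are phi(-q) and phi(-q^2), split by exponents modulo 3;
   e, e4, e6 are E_2, E_4, E_6, w is (q^2; q^4) and h is 1 / E_2. *)
Lemma dp_dissect_algebra (A : comNzRingType)
    (x a a' b b' o e w e4 e6 u psi h d : A) :
  a + a' = o ^+ 2 * e -> b + b' = w ^+ 2 * e4 -> a' = x * (u * e6) ^+ 3 ->
  psi * o = e -> e6 = e ^+ 3 -> e = w * e4 -> u * o ^+ 2 = 1 -> e * h = 1 ->
  d * (u * e4) = 1 ->
  d = x * (psi ^+ 3) ^+ 2 * b + (a * b + a' * b' + a * b') * h ^+ 3.
Proof.
move=> aE bE a'E psiE e6E eE uo eh dE.
(* As u o^2 = 1 and e h = 1, psi^2 = u (psi o)^2 = u e^2 = u e^3 h. *)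
have psi2 : psi ^+ 2 = u * e6 * h.
  rewrite e6E -[LHS]mulr1 -uo mulrCA -exprMn psiE -[LHS]mulr1 -eh; ring.
have -> : x * (psi ^+ 3) ^+ 2 * b = a' * b * h ^+ 3.
  by rewrite exprAC psi2 a'E; ring.
(* The four products assemble into phi(-q) phi(-q^2); there remains D = phi(-q) phi(-q^2) /
   E_2^3. *)
have -> : a' * b * h ^+ 3 + (a * b + a' * b' + a * b') * h ^+ 3 =
          (a + a') * (b + b') * h ^+ 3 by ring.
rewrite aE bE; have -> : o ^+ 2 * e * (w ^+ 2 * e4) * h ^+ 3 =
  o ^+ 2 * w * h * (w * e4 * h) * (e * h) by ring.
rewrite -eE eh !mulr1 -[RHS]mul1r -dE.
have -> : d * (u * e4) * (o ^+ 2 * w * h) = d * (u * o ^+ 2) * (w * e4 * h) by ring.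
by rewrite uo -eE eh !mulr1.
Qed.

Section CharThree.
Variables (A : comUnitRingType) (char3 : 3%N \in [pchar A]).
Variables (x : A) (M : nat) (x0 : x ^+ M = 0).

Lemma qpoch_cube (a Q : A) n : qpoch a Q n ^+ 3 = qpoch (a ^+ 3) (Q ^+ 3) n.
Proof.
rewrite -prodrXl; apply: eq_bigr => i _.
by rewrite -(pFrobenius_autE char3) rmorphB rmorph1 rmorphM rmorphXn.
Qed.

Lemma theta_cube N (a b : A) : theta N a b ^+ 3 = theta N (a ^+ 3) (b ^+ 3).
Proof.
rewrite -(pFrobenius_autE char3) rmorph_sum; apply: eq_bigr => i _.
by rewrite rmorphM !rmorphXn.
Qed.

Let P r s := qpoch (x ^+ r) (x ^+ s) M.

Let nilpX r : (0 < r)%N -> (x ^+ r) ^+ M = 0.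
Proof. by case: r => // r _; rewrite exprS; apply: nilpM. Qed.

Let P_dissect m r s : (0 < m)%N -> (0 < s)%N ->
  P r s = \prod_(k < m) P (r + s * k) (s * m).
Proof.
move=> m0 s0; rewrite /P (@qpoch_nilp_dissect A M _ _ m m0) ?nilpX //.
by apply: eq_bigr => k _; rewrite -!exprM -exprD.
Qed.

Let P_unit r s : (0 < r)%N -> P r s \is a GRing.unit.
Proof. by move=> r0; apply/qpoch_unit/nilpX. Qed.

(** [dp_part] depends only on the residue modulo 12, and each class receives M factors. Classes 1, 7
    form (q; q^6), classes 5, 11 form (q^5; q^6), and classes 4, 8, 12 form (q^4; q^4). *)
Lemma dp_product :
  \prod_(i < 12 * M) (if dp_part i.+1 then 1 - x ^+ i.+1 else 1) =
  P 1 6 * P 5 6 * P 4 4.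
Proof.
rewrite (prod_dissect (fun i => if dp_part i.+1 then 1 - x ^+ i.+1 else 1)).
rewrite (eq_bigr (fun r : 'I_12 => if dp_part r.+1 then P r.+1 12 else 1)).
  rewrite !big_ord_recl big_ord0 /=.
  rewrite !(@P_dissect 2 _ 6) // (@P_dissect 3 4 4) //.
  rewrite !big_ord_recl !big_ord0 /=.
  by rewrite /bump /= !mul1r !mulr1 -!mulrA; ring.
move=> r _; case: ifP => dp_r.
  apply: eq_bigr => j _; rewrite -exprM -exprD.
  suff -> : dp_part (12 * j + r).+1 by congr (1 - x ^+ _); lia.
  by move: dp_r; rewrite /dp_part; lia.
rewrite big1 // => j _.
suff -> : dp_part (12 * j + r).+1 = false by [].
by move: dp_r; rewrite /dp_part; lia.
Qed.

Variable N : nat.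
Hypothesis leMN : (M.*2 <= N)%N.

Let triple_productX (r s : nat) : (0 < r)%N -> (0 < s)%N ->
  theta N (- x ^+ r) (- x ^+ s) = P r (r + s) * P s (r + s) * P (r + s) (r + s).
Proof. by move=> r0 s0; rewrite (triple_product _ _ leMN) ?nilpX // -exprD. Qed.

(** Gauss's product for psi(q): the triple product gives (-q; q^2) (q^4; q^4), and (-q; q^2) (q;
    q^2) = (q^2; q^4). *)
Lemma triple_product_psi : theta N x (x ^+ 3) * P 1 2 = P 2 2.
Proof.
have := @triple_product A M (- x) (- x ^+ 3) N; rewrite !opprK mulrNN -exprS => ->//.
- have x2_dissect : qpoch (- x) (x ^+ 2) M =
      qpoch (- x) (x ^+ 4) M * qpoch (- x ^+ 3) (x ^+ 4) M.
    rewrite (@qpoch_nilp_dissect A M _ _ 2) ?nilpX // !big_ord_recl big_ord0 /=.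
    by rewrite expr0 !mulr1 mulNr -exprS -exprM.
  rewrite -x2_dissect -/(P 4 4) mulrAC {1}/P expr1 qpoch_oppM -exprM.
  by rewrite (@P_dissect 2 2 2) // !big_ord_recl big_ord0 /= mulr1 /P.
- by rewrite exprNn x0 mulr0.
by rewrite exprNn nilpX // mulr0.
Qed.

Lemma dp_dissect d :
  d * \prod_(i < 12 * M) (if dp_part i.+1 then 1 - x ^+ i.+1 else 1) = 1 ->
  exists h,
    d = x * theta N (x ^+ 3) (x ^+ 9) ^+ 2 * theta_mod0 N (- x ^+ 2) +
        (theta_mod0 N (- x) * theta_mod0 N (- x ^+ 2) +
         theta_mod1 N (- x) * theta_mod1 N (- x ^+ 2) +
         theta_mod0 N (- x) * theta_mod1 N (- x ^+ 2)) * h ^+ 3.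
Proof.
rewrite dp_product => dE; exists (P 2 2)^-1.
have leMN3 : (M.*2 <= 3 * N + 1)%N by lia.
have phi1 : theta (3 * N + 1) (- x) (- x) = P 1 2 ^+ 2 * P 2 2.
  by rewrite (triple_product _ _ leMN3) // -expr2.
have phi2 : theta (3 * N + 1) (- x ^+ 2) (- x ^+ 2) = P 2 4 ^+ 2 * P 4 4.
  by rewrite (triple_product _ _ leMN3) ?nilpX // -exprD -expr2.
(* By Frobenius, f(-q^3, -q^15) = f(-q, -q^5)^3. *)
have f3 : theta N ((- x) ^+ 3) ((- x) ^+ 15) = (P 1 6 * P 5 6 * P 6 6) ^+ 3.
  have := triple_productX (isT : 0 < 1)%N (isT : 0 < 5)%N => <-.
  by rewrite theta_cube; congr (theta N _ _); ring.
have psi3 : theta N x (x ^+ 3) ^+ 3 = theta N (x ^+ 3) (x ^+ 9).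
  by rewrite theta_cube -exprM.
have psi := triple_product_psi.
have P36 : P 3 6 = P 1 2 ^+ 3 by rewrite qpoch_cube -!exprM.
have P66 : P 6 6 = P 2 2 ^+ 3 by rewrite qpoch_cube -!exprM.
have P12 : P 1 2 = P 1 6 * P 3 6 * P 5 6.
  by rewrite (@P_dissect 3) // !big_ord_recl big_ord0 /= mulr1 mulrA.
have P22 : P 2 2 = P 2 4 * P 4 4.
  by rewrite (@P_dissect 2) // !big_ord_recl big_ord0 /= mulr1.
(* [P12] and [P36] give P 1 2 = P 1 6 * P 5 6 * P 1 2 ^+ 3, where the unit P 1 2 cancels. *)
have uo : P 1 6 * P 5 6 * P 1 2 ^+ 2 = 1.
  apply: (mulIr (P_unit 2 (isT : 0 < 1)%N)).
  by rewrite mul1r [RHS]P12 P36; ring.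
have hE : P 2 2 / P 2 2 = 1 by rewrite divrr // P_unit.
rewrite theta_dissect in phi1; rewrite theta_dissect in phi2.
have thr : 3%:R = 0 :> A by exact: pcharf0 char3.
(* The factor 2 in [theta_mod1] is - 1 here and cancels the sign of - x. *)
have mod1E : theta_mod1 N (- x) = x * (P 1 6 * P 5 6 * P 6 6) ^+ 3.
  rewrite /theta_mod1 f3; set F := _ ^+ 3.
  have -> : (- x * F) *+ 2 = x * F - 3%:R * (x * F) by ring.
  by rewrite thr mul0r subr0.
rewrite -psi3.
exact: (dp_dissect_algebra phi1 phi2 mod1E psi P66 P22 uo hE dE).
Qed.

End CharThree.

(** * Supports of polynomials *)

(** The exponent is 3 T with T = k (2 k - 1) triangular, and a triangular number is 0 modulo 3 or 1
    modulo 9. *)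
Lemma tri_psi_mod (k : int) :
  ((3 * tri k + 9 * tri (k - 1)) %% 9 == 0)%N || ((3 * tri k + 9 * tri (k - 1)) %% 27 == 3)%N.
Proof.
have E : (3 * tri k + 9 * tri (k - 1))%N%:Z = 3 * (2 * k * k - k).
  by have := tri_double k; have := tri_succ k; nia.
have [q [r [Ek rE]]] : exists q r : int, k = 3 * q + r /\ (r = 0 \/ r = 1 \/ r = 2).
  exists (k %/ 3)%Z, (k %% 3)%Z; lia.
move: E; rewrite Ek; move: (3 * tri _ + _)%N => t.
by case: rE => [|[]] ->; nia.
Qed.

(** The sum is k^2, and 2 is not a square modulo 3. *)
Lemma tri_sum_mod3 (k : int) : ((tri k + tri (k - 1)) %% 3 <= 1)%N.
Proof.
have E : (tri k + tri (k - 1))%N%:Z = k * k.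
  by have := tri_double k; have := tri_succ k; nia.
have [q [r [Ek rE]]] : exists q r : int, k = 3 * q + r /\ (r = 0 \/ r = 1 \/ r = 2).
  exists (k %/ 3)%Z, (k %% 3)%Z; lia.
move: E; rewrite Ek; move: (tri _ + _)%N => t.
by case: rE => [|[]] ->; nia.
Qed.

Section Supports.
Variable R : comNzRingType.
Implicit Types (p q : {poly R}) (S T V : pred nat).

Definition supported S p :=
  all (fun i => (p`_i != 0) ==> S i) (iota 0 (size p)).

Lemma supportedP S p : reflect (forall i, ~~ S i -> p`_i = 0) (supported S p).
Proof.
apply: (iffP allP) => [Sp i nSi | Sp i _]; last first.
  by apply/implyP; apply: contraNT => /Sp->.
have [lt_ip | /leq_sizeP/(_ i (leqnn i)) //] := ltnP i (size p).
by have := Sp i; rewrite mem_iota lt_ip (negPf nSi) implybF negbK => /(_ isT)/eqP.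
Qed.

Lemma supported_neq0 S p i : supported S p -> p`_i != 0 -> S i.
Proof. by move=> /supportedP Sp; apply: contraNT => /Sp->. Qed.

Lemma supportedW S T p : supported S p -> (forall i, S i -> T i) -> supported T p.
Proof.
by move=> /supportedP Sp ST; apply/supportedP => i nTi; rewrite Sp // (contra (ST i)).
Qed.

Lemma supportedD S p q : supported S p -> supported S q -> supported S (p + q).
Proof.
move=> /supportedP Sp /supportedP Sq; apply/supportedP => i nSi.
by rewrite coefD Sp ?Sq ?addr0.
Qed.

Lemma supportedN S p : supported S p -> supported S (- p).
Proof.
by move=> /supportedP Sp; apply/supportedP => i nSi; rewrite coefN Sp ?oppr0.
Qed.

Lemma supported_sum S I (r : seq I) (P : pred I) (F : I -> {poly R}) :
  (forall i, P i -> supported S (F i)) -> supported S (\sum_(i <- r | P i) F i).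
Proof.
move=> SF; apply: (big_ind (supported S)) => //; last exact: supportedD.
by apply/supportedP => i _; rewrite coef0.
Qed.

Lemma supportedM S T V p q : supported S p -> supported T q ->
  (forall i j, S i -> T j -> V (i + j)%N) -> supported V (p * q).
Proof.
move=> Sp Tq STV; apply/supportedP => i nV.
rewrite coefM big1 // => j _.
have [->|/(supported_neq0 Sp) Sj] := eqVneq p`_j 0; first by rewrite mul0r.
have [->|/(supported_neq0 Tq) Tj] := eqVneq q`_(i - j) 0; first by rewrite mulr0.
by case/negP: nV; rewrite -(subnKC (leq_ord j)); apply: STV.
Qed.

Arguments supportedM {S T V p q}.

Lemma supportedXn (n : nat) : supported (pred1 n) 'X^n.
Proof. by apply/supportedP => i /negPf /= ni; rewrite coefXn ni. Qed.

Lemma supported_exp (s : nat) p n :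
  supported (pred1 s) p -> supported (pred1 (s * n)%N) (p ^+ n).
Proof.
move=> Sp; elim: n => [|n IHn]; first by rewrite muln0 expr0 -(expr0 'X); apply: supportedXn.
rewrite exprS; apply: (supportedM Sp IHn) => i j /eqP-> /eqP->.
by rewrite /= mulnS.
Qed.

Lemma supported_theta S N (s t : nat) a b : supported (pred1 s) a -> supported (pred1 t) b ->
  (forall k : int, S (s * tri k + t * tri (k - 1))%N) -> supported S (theta N a b).
Proof.
move=> Sa Sb Sst; apply: supported_sum => j _; rewrite /theta_term.
apply: (supportedM (supported_exp _ Sa) (supported_exp _ Sb)) => i l /eqP-> /eqP->.
exact: Sst.
Qed.

Arguments supported_theta {S} N {s t a b}.

(** By Frobenius, p^3 is the sum of the p_i^3 X^(3 i). *)
Lemma supported_cube p : 3%N \in [pchar R] -> supported (fun i => 3 %| i)%N (p ^+ 3).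
Proof.
move=> char3.
have char3p : 3%N \in [pchar {poly R}] by rewrite pchar_poly.
rewrite -[p]coefK poly_def -(pFrobenius_autE char3p) rmorph_sum /=.
apply: supported_sum => i _; rewrite pFrobenius_autE exprZn -exprM -mul_polyC.
apply: (@supportedM (pred1 0%N) (pred1 (i * 3)%N)); last 2 first.
- exact: supportedXn.
- by move=> j k /eqP-> /eqP->; rewrite dvdn_mull.
by apply/supportedP => j /negPf /= nj; rewrite coefC nj.
Qed.

(** The exponents are 9 s k^2, with k^2 equal to 0 or 1 modulo 3. *)
Lemma supported_theta_mod0 N (s : nat) z : supported (pred1 s) z ->
  supported (fun i => i %% (9 * s * 3) \in [:: 0; 9 * s])%N (theta_mod0 N z).
Proof.
move=> Sz; rewrite /theta_mod0.
apply: (supported_theta _ (supported_exp 9 Sz) (supported_exp 9 Sz)) => k.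
rewrite -mulnDr [(s * 9)%N]mulnC -muln_modr !inE muln_eq0.
by have := tri_sum_mod3 k; rewrite leq_eqVlt ltnS leqn0 orbC => /orP[->|/eqP->];
  rewrite ?orbT // muln1 eqxx orbT.
Qed.

Lemma supported_theta_mod1 N (s : nat) z : supported (pred1 s) z ->
  supported (fun i => i == s %[mod 3])%N (theta_mod1 N z).
Proof.
move=> Sz; rewrite /theta_mod1 mulr2n.
suff Sz1 : supported (fun i => i == s %[mod 3])%N (z * theta N (z ^+ 3) (z ^+ 15)).
  exact: supportedD.
apply: (supportedM (T := fun i => 3 %| i)%N Sz).
  apply: (supported_theta _ (supported_exp 3 Sz) (supported_exp 15 Sz)) => k.
  by rewrite dvdn_add // dvdn_mulr // dvdn_mull.
by move=> i j /eqP-> /=; lia.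
Qed.

End Supports.

(** * Coefficients of the dissected series *)

Lemma rmorph_theta (R S : comNzRingType) (f : {rmorphism R -> S}) N a b :
  f (theta N a b) = theta N (f a) (f b).
Proof.
rewrite rmorph_sum; apply: eq_bigr => j _.
by rewrite rmorphM !rmorphXn.
Qed.

Lemma rmorph_theta_mod0 (R S : comNzRingType) (f : {rmorphism R -> S}) N z :
  f (theta_mod0 N z) = theta_mod0 N (f z).
Proof. by rewrite rmorph_theta rmorphXn. Qed.

Lemma rmorph_theta_mod1 (R S : comNzRingType) (f : {rmorphism R -> S}) N z :
  f (theta_mod1 N z) = theta_mod1 N (f z).
Proof. by rewrite rmorphMn rmorphM rmorph_theta !rmorphXn. Qed.

(** The successor keeps the modulus nonconstant, so that [mk_monic] leaves it unchanged. *)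
Lemma in_qpolyXn_eq (R : comNzRingType) M (p q : {poly R}) i :
  in_qpoly ('X^(M.+1)) p = in_qpoly ('X^(M.+1)) q -> (i < M.+1)%N -> p`_i = q`_i.
Proof.
move=> /(congr1 val) /=; rewrite mk_monic_Xn /= -!Pdiv.RingMonic.take_poly_rmodp.
move=> /(congr1 (fun r : {poly R} => r`_i)); rewrite !coef_take_poly => + ltiM.
by rewrite ltiM.
Qed.

Lemma dp_poly_dissect M N : (M.+1.*2 <= N)%N ->
  exists h : {poly 'F_3}, forall i, (i < M.+1)%N ->
  (dp i)%:R = ('X * theta N ('X ^+ 3) ('X ^+ 9) ^+ 2 * theta_mod0 N (- 'X^2) +
        (theta_mod0 N (- 'X) * theta_mod0 N (- 'X^2) +
         theta_mod1 N (- 'X) * theta_mod1 N (- 'X^2) +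
         theta_mod0 N (- 'X) * theta_mod1 N (- 'X^2)) * h ^+ 3)`_i :> 'F_3.
Proof.
move=> leMN.
pose f : {rmorphism {poly 'F_3} -> {poly %/ ('X^(M.+1) : {poly 'F_3})}} := in_qpoly _.
pose x := f 'X.
have x0 : x ^+ M.+1 = 0.
  rewrite /x -rmorphXn /=; apply/val_inj => /=; rewrite mk_monic_Xn.
  by rewrite Pdiv.RingMonic.rmodpp ?monicXn.
have char3 : 3%N \in [pchar {poly %/ ('X^(M.+1) : {poly 'F_3})}].
  by rewrite pchar_qpoly pchar_Fp.
(* As [x] is nilpotent, each truncated geometric series inverts its factor in the quotient. *)
have gfE : f (partition_poly _ M.+1 dp_part (12 * M.+1)) *
    \prod_(i < 12 * M.+1) (if dp_part i.+1 then 1 - x ^+ i.+1 else 1) = 1.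
  rewrite /partition_poly rmorph_prod -big_split big1 //= => i _.
  case: ifP => _; last by rewrite rmorph1 mulr1.
  rewrite mulrC /geom_poly rmorph_sum.
  under eq_bigr do rewrite !rmorphXn /=.
  by rewrite geom_nilp // exprAC x0 expr0n.
have [h hE] := dp_dissect char3 x0 leMN gfE.
(* Lifting h itself keeps h^3 the cube of a polynomial, as [supported_cube] requires. *)
exists (val h) => i ltiM.
rewrite -(coef_dp_poly _ ltiM (_ : i <= 12 * M.+1)%N); last by lia.
apply: in_qpolyXn_eq ltiM; rewrite -/f hE.
have fh : f (val h) = h.
  by apply: val_inj; apply: in_qpoly_small; apply: size_mk_monic.
rewrite !(rmorphD, rmorphM, rmorphXn, rmorphN, rmorph_theta, rmorph_theta_mod0,
  rmorph_theta_mod1) /=.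
by rewrite fh.
Qed.

Lemma dp_eq0_mod3 (n : nat) : (dp (27 * n + 16))%:R = 0 :> 'F_3.
Proof.
pose M := (27 * n + 16)%N.
have [h hE] := @dp_poly_dissect M M.+1.*2 (leqnn _).
have := hE M (ltnSn _).
have char3 := pchar_Fp (isT : prime 3).
set N := M.+1.*2.
have SX : supported (pred1 1%N) ('X : {poly 'F_3}) by exact: supportedXn _ 1.
have SXN := supportedN SX.
have SX2 : supported (pred1 2%N) (- 'X^2 : {poly 'F_3}) by exact/supportedN/supportedXn.
set main := 'X * _ * _; set rest := _ * h ^+ 3.
have main0 : main`_M = 0.
  pose S i := (i %% 9 == 0)%N || (i %% 27 == 3)%N.
  have Spsi : supported S (theta N ('X^3) ('X^9) : {poly 'F_3}).
    apply: (supported_theta N (supportedXn _ 3) (supportedXn _ 9)).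
    exact: tri_psi_mod.
  suff Smain : supported (fun i => i %% 27 != 16)%N main.
    by apply: (supportedP _ _ Smain); rewrite negbK /M; lia.
  (* Sums of two exponents of psi(q^3): 0 + 0 or 0 + 3 modulo 9, or 3 + 3 modulo 27. *)
  pose S2 i := (i %% 9 \in [:: 0; 3])%N || (i %% 27 == 6)%N.
  have Spsi2 : supported S2 (theta N ('X^3) ('X^9) ^+ 2 : {poly 'F_3}).
    rewrite expr2; apply: (supportedM Spsi Spsi) => i j.
    by rewrite /S /S2 !inE; lia.
  have SXpsi2 : supported (fun i => (0 < i)%N && S2 i.-1)
      ('X * theta N ('X^3) ('X^9) ^+ 2 : {poly 'F_3}).
    by apply: (supportedM SX Spsi2) => i j /eqP->; rewrite add1n.
  have S18 : supported (fun i => i %% 27 \in [:: 0; 18])%N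
      (theta_mod0 N (- 'X^2) : {poly 'F_3}).
    by apply: supportedW (supported_theta_mod0 N SX2) _ => i; rewrite !inE; lia.
  (* The exponents of [main] are 1 or 4 modulo 9, or 7 or 25 modulo 27; but 16 is 7 modulo 9. *)
  apply: (supportedM SXpsi2 S18) => i j.
  by rewrite /S2 !inE; lia.
have rest0 : rest`_M = 0.
  (* Modulo 3 the exponents are 0 + 0, 1 + 2 and 0 + 2, and the cube adds 0, whereas M is 1 modulo
     3. *)
  suff Srest : supported (fun i => i %% 3 != 1)%N rest.
    by apply: (supportedP _ _ Srest); rewrite negbK /M; lia.
  suff Sprod : supported (fun i => i %% 3 != 1)%N
      (theta_mod0 N (- 'X) * theta_mod0 N (- 'X^2) +
       theta_mod1 N (- 'X) * theta_mod1 N (- 'X^2) +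
       theta_mod0 N (- 'X) * theta_mod1 N (- 'X^2) : {poly 'F_3}).
    by apply: (supportedM Sprod (supported_cube h char3)) => i j; lia.
  have S0 := supported_theta_mod0 N SXN; have S0' := supported_theta_mod0 N SX2.
  have S1 := supported_theta_mod1 N SXN; have S1' := supported_theta_mod1 N SX2.
  apply: supportedD; first apply: supportedD.
  - by apply: (supportedM S0 S0') => i j; rewrite !inE; lia.
  - by apply: (supportedM S1 S1') => i j; lia.
  by apply: (supportedM S0 S1') => i j; rewrite !inE; lia.
by rewrite coefD main0 rest0 addr0.
Qed.

Local Close Scope ring_scope.

Theorem theorem1p4 (n : nat) : dp (27 * n + 16) = 0 %[mod 3].
Proof.
apply/eqP; rewrite mod0n [_ == _](dvdn_pcharf (pchar_Fp (isT : prime 3))).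
by rewrite dp_eq0_mod3.
Qed.
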